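(* For every integer $n\ge1$, $$\sum_{\nu\in\mathcal{Q}_{n}}q^{\mathrm{maj}(\nu)}=\frac{1}{[n+2]}\genfrac{[}{]}{0pt}{}{2(n+1)}{n+1}.$$
   Context: A Dyck path of length $m$ is a word in $\{0,1\}$ with $m$ letters $0$ and $m$ letters $1$ in which every prefix contains at least as many $0$'s as $1$'s; it is prime if it is non-empty and returns to balance (equal numbers of $0$'s and $1$'s in a non-empty prefix) only at its end. A Dyck path $\mu=\mu_1\cdots\mu_{2m}$ is symmetric if $\mu=\overline{\mu_{2m}}\cdots\overline{\mu_1}$ with $\overline0=1$, $\overline1=0$. A symmetric Dyck path is identified with its first half $\nu=\mu_1\cdots\mu_m$. For $1\le i\le m$ with $\mu_i=0$ let $j>i$ be minimal such that $\mu_i\cdots\mu_j$ is a prime Dyck path; the pair $(i,j)$ is an arch if $j\le m$, and $i$ is a half-arch if $j\ge m+1$. The size of a symmetric Dyck path is the number of its arches plus the number of its half-arches, and $\mathcal{Q}_n$ is the set of symmetric Dyck paths of size $n$ (so $m$ varies). For $\nu=\nu_1\cdots\nu_m$, the descent set $\mathrm{Des}(\nu)$ consists of all $1\le i\le m-1$ with $(\nu_i,\nu_{i+1})=(1,0)$, together with $m$ if $\nu_m=1$; and $\mathrm{maj}(\nu):=\sum_{i\in\mathrm{Des}(\nu)}i$. Here $[k]:=\sum_{i=0}^{k-1}q^i$ and $\genfrac{[}{]}{0pt}{}{m}{k}:=\frac{(q)_m}{(q)_k(q)_{m-k}}$ with $(q)_m:=(1-q)(1-q^2)\cdots(1-q^m)$.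 *)

(* Defs.v *)
From HB Require Import structures.
From mathcomp Require Import all_boot all_order all_algebra.
From mathcomp Require Import boolp classical_sets fsbigop.

Set Implicit Arguments.
Unset Strict Implicit.
Unset Printing Implicit Defensive.
Import GRing.Theory.

(* The letters 0 and 1 are [false] and [true]; positions in words are numbered
   from 1. *)
Definition word := seq bool.

Definition zeros (w : word) : nat := count_mem false w.
Definition ones (w : word) : nat := count_mem true w.

Definition letter (w : word) (i : nat) : bool := nth false w i.-1.

(* The factor w_i ... w_j, for 1 <= i <= j <= size w. *)
Definition factor (w : word) (i j : nat) : word := drop i.-1 (take j w).

Definition dyck (w : word) : bool :=
  (zeros w == ones w) &&
  all (fun k => ones (take k w) <= zeros (take k w)) (iota 0 (size w).+1).

Definition prime_dyck (w : word) : bool :=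
  [&& dyck w, w != [::] &
      all (fun k => zeros (take k w) != ones (take k w))
          (iota 1 (size w).-1)].

Definition symmetric_word (w : word) : bool := w == map negb (rev w).

Definition first_half (mu : word) : word := take (size mu)./2 mu.

(* For mu_i = 0, (i, j) is an arch when j <= m and i is a half-arch when j > m,
   where m is the half-length: j is the least index > i such that
   mu_i ... mu_j is a prime Dyck path. *)
Definition closes (mu : word) (i j : nat) : bool :=
  [&& i < j, j <= size mu, prime_dyck (factor mu i j) &
      all (fun k => ~~ prime_dyck (factor mu i k)) (iota i.+1 (j - i.+1))].

Definition arches (mu : word) : seq (nat * nat) :=
  let m := (size mu)./2 in
  [seq p <- [seq (i, j) | i <- iota 1 m, j <- iota 1 m]
     | (letter mu p.1 == false) && closes mu p.1 p.2].

Definition half_arches (mu : word) : seq nat :=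
  let m := (size mu)./2 in
  [seq i <- iota 1 m
     | (letter mu i == false) && has (closes mu i) (iota m.+1 m)].

Definition path_size (mu : word) : nat :=
  size (arches mu) + size (half_arches mu).

(* The half-length of the path is not bounded a priori, hence a set rather than
   a finType; a path of size n has half-length at most 2n, so this set is finite.
   Were it infinite, [\sum_(mu \in symDyck n) q ^+ _] would default to 0. *)
Definition symDyck (n : nat) : set word :=
  [set mu | [&& dyck mu, symmetric_word mu & path_size mu == n]]%classic.

Definition Des (nu : word) : seq nat :=
  let m := size nu in
  [seq i <- iota 1 m.-1 | (letter nu i, letter nu i.+1) == (true, false)] ++
  (if letter nu m then [:: m] else [::]).

Definition maj (nu : word) : nat := \sum_(i <- Des nu) i.

Local Open Scope ring_scope.

Definition qint (F : fieldType) (q : F) (k : nat) : F := \sum_(i < k) q ^+ i.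

Definition qpoch (F : fieldType) (q : F) (m : nat) : F :=
  \prod_(1 <= i < m.+1) (1 - q ^+ i).

Definition qbinom (F : fieldType) (q : F) (m k : nat) : F :=
  qpoch q m / (qpoch q k * qpoch q (m - k)).

(* The indeterminate of the field Q(q) of rational functions, in which the
   quotients defining q-binomials are genuine. *)
Definition qvar : {fraction {poly rat}} := tofrac ('X : {poly rat}).

(* Main.v *)
Require Import Defs.
From HB Require Import structures.
From mathcomp Require Import all_boot all_order all_algebra.
From mathcomp Require Import boolp classical_sets fsbigop.
From mathcomp Require Import ring zify.

Set Implicit Arguments.
Unset Strict Implicit.
Unset Printing Implicit Defensive.
Import GRing.Theory.

(** In the first half [nu] of a symmetric Dyck path every letter 0 is matched,
    either inside [nu] (an arch) or beyond it (a half-arch), so the size of the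
    path is the number of 0's in [nu]; and [nu] ranges over all ballot words.
    The sum thus runs over the ballot words with n zeros, of any length.

    The descent at the end of [nu] when its last letter is 1 is the descent that
    [nu] acquires when a 0 is appended to it: [maj nu] is the ordinary major
    index of [nu ++ [:: false]].  Completing this word by 1's, which creates no
    descent, gives each Dyck word with n + 1 zeros exactly once, so the sum is
    MacMahon's maj-enumeration of Dyck words, a q-Catalan number.

    Let f(a, b) and F(a, b) be the generating functions of the ordinary major
    index [inner_maj] and of [maj] over the ballot words with a zeros and b ones.
    Deleting the last letter gives, for b <= a,
      f(a, b) = F(a - 1, b) + f(a, b - 1),
      F(a, b) = F(a - 1, b) + q^(a + b) f(a, b - 1),
    whose solution, a q-analogue of the reflection principle, is
      f(a, b) = [a + b, b] - q [a + b, b - 1],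
      F(a, b) = q^b ([a + b, b] - [a + b, b - 1])
    in terms of Gaussian binomials (lemma [ballotGF_closed]).  The first
    recurrence telescopes: the sum of F(n, b) over b is f(n + 1, n + 1)
    (lemma [sum_maj_inner]), which is the right-hand side. *)

(** * Ballot words *)

Local Open Scope nat_scope.

Definition ballot (w : word) : bool :=
  all (fun k => ones (take k w) <= zeros (take k w)) (iota 0 (size w).+1).

(** The usual major index of a word, without the extra descent that [Des] puts
    at the end of a word whose last letter is 1. *)
Definition inner_maj (w : word) : nat :=
  \sum_(i <- iota 1 (size w).-1 | (letter w i, letter w i.+1) == (true, false)) i.

Fixpoint words (m : nat) : seq word :=
  if m is m'.+1 then
    [seq rcons w false | w <- words m'] ++ [seq rcons w true | w <- words m']
  else [:: [::]].

Fixpoint words_lt (m : nat) : seq word :=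
  if m is m'.+1 then words_lt m' ++ words m' else [::].

Lemma zeros_rcons w x : zeros (rcons w x) = zeros w + ~~ x.
Proof. by rewrite /zeros -cats1 count_cat /= addn0; case: x. Qed.

Lemma ones_rcons w x : ones (rcons w x) = ones w + x.
Proof. by rewrite /ones -cats1 count_cat /= addn0; case: x. Qed.

Lemma zeros_cat u v : zeros (u ++ v) = zeros u + zeros v.
Proof. exact: count_cat. Qed.

Lemma ones_cat u v : ones (u ++ v) = ones u + ones v.
Proof. exact: count_cat. Qed.

Lemma zerosDones w : zeros w + ones w = size w.
Proof. by elim: w => //= -[] w; rewrite /zeros /ones /=; lia. Qed.

Lemma ballotP w :
  reflect (forall k, ones (take k w) <= zeros (take k w)) (ballot w).
Proof.
apply: (iffP allP) => [H k|H k _]; last exact: H.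
have [lekw|ltwk] := leqP k (size w).
  by apply: H; rewrite mem_iota; lia.
have := H (size w); rewrite take_size take_oversize; last exact: ltnW.
by apply; rewrite mem_iota; lia.
Qed.

Lemma ballot_le w : ballot w -> ones w <= zeros w.
Proof. by move=> /ballotP/(_ (size w)); rewrite take_size. Qed.

Lemma ballot_rcons w x :
  ballot (rcons w x) = ballot w && (ones w + x <= zeros w + ~~ x).
Proof.
apply/ballotP/andP => [H|[/ballotP H le_x] k].
  split; last first.
    by have := H (size (rcons w x)); rewrite take_size zeros_rcons ones_rcons.
  apply/ballotP => k; have [lekw|ltwk] := leqP k (size w).
    by have := H k; rewrite -cats1 takel_cat.
  rewrite take_oversize; last exact: ltnW.
  by have := H (size w); rewrite -cats1 takel_cat // take_size.
have [lekw|ltwk] := leqP k (size w).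
  by rewrite -cats1 takel_cat.
by rewrite take_oversize ?size_rcons // zeros_rcons ones_rcons.
Qed.

Lemma mem_words m w : (w \in words m) = (size w == m).
Proof.
elim: m w => [|m IHm] w; first by rewrite inE size_eq0.
rewrite /= mem_cat; case/lastP: w => [|w x].
  by apply/orP; case=> /mapP[[|? ?]].
have inj_rcons y : injective (fun w : word => rcons w y).
  by move=> u v /rcons_inj[].
have mem_false y :
    y != x -> (rcons w x \in [seq rcons u y | u <- words m]) = false.
  by move=> neq; apply/mapP => -[u _ /rcons_inj[_ eq]]; rewrite eq eqxx in neq.
rewrite size_rcons eqSS -IHm.
case: x mem_false => memF; first by rewrite (memF false isT) (mem_map (inj_rcons _)).
by rewrite (memF true isT) orbF (mem_map (inj_rcons _)).
Qed.

Lemma words_uniq m : uniq (words m).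
Proof.
elim: m => //= m IHm; rewrite cat_uniq !map_inj_uniq ?IHm //;
  try by move=> u v /rcons_inj[].
by rewrite andbT; apply/hasPn => _ /mapP[u _ ->]; apply/mapP => -[v _ /rcons_inj[]].
Qed.

Lemma mem_words_lt m w : (w \in words_lt m) = (size w < m).
Proof.
elim: m => [|m IHm]; first by rewrite ltn0.
by rewrite /= mem_cat IHm mem_words ltnS orbC -leq_eqVlt.
Qed.

Lemma words_lt_uniq m : uniq (words_lt m).
Proof.
elim: m => //= m IHm; rewrite cat_uniq IHm words_uniq andbT.
by apply/hasPn => w; rewrite /= mem_words mem_words_lt => /eqP->; rewrite ltnn.
Qed.

(** * The major index and the last letter *)

Lemma majE w :
  maj w = inner_maj w + (if letter w (size w) then size w else 0).
Proof.
rewrite /maj /Des big_cat big_filter /=; congr (_ + _).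
by case: ifP => _; rewrite ?big_seq1 ?big_nil.
Qed.

Lemma letter_rcons w x i :
  letter (rcons w x) i.+1 =
    if i < size w then letter w i.+1 else if i == size w then x else false.
Proof. by rewrite /letter /= nth_rcons. Qed.

(** For [x = false] this is the reason for the convention in [Des]: a final 1 is
    a descent as if the word were followed by a 0. *)
Lemma inner_maj_rcons w x :
  inner_maj (rcons w x) = if x then inner_maj w else maj w.
Proof.
case/lastP: w => [|w y]; first by rewrite majE /inner_maj /= !big_nil; case: x.
(* Appending [x] to a non-empty word only tests one more position, the one of
   its former last letter [y]. *)
have -> : inner_maj (rcons (rcons w y) x) =
  inner_maj (rcons w y) + (if y && ~~ x then (size w).+1 else 0).
  have iotaS : iota 1 (size w).+1 = iota 1 (size w) ++ [:: (size w).+1].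
    by rewrite -[in iota _ _](addn1 (size w)) iotaD add1n.
  rewrite /inner_maj !size_rcons [_.-1]/= [_.-1 in RHS]/= iotaS big_cat /=.
  congr (_ + _).
    rewrite big_mkcond [RHS]big_mkcond; apply: eq_big_seq => i.
    rewrite mem_iota => /andP[i_gt0 lti].
    case: i i_gt0 lti => // i _ lti.
    have eq_letter j : j <= size w ->
        letter (rcons (rcons w y) x) j.+1 = letter (rcons w y) j.+1.
      by move=> lejw; rewrite letter_rcons size_rcons ltnS lejw.
    by rewrite !eq_letter //; lia.
  rewrite big_mkcond big_seq1 !letter_rcons size_rcons !(ltnSn, ltnn, eqxx).
  by case: x y => -[].
rewrite majE size_rcons letter_rcons ltnn eqxx.
by case: x y => -[]; rewrite ?addn0.
Qed.

Lemma maj_rcons w x :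
  maj (rcons w x) = if x then inner_maj w + (size w).+1 else maj w.
Proof.
rewrite majE inner_maj_rcons size_rcons letter_rcons ltnn eqxx.
by case: x; rewrite ?addn0.
Qed.

(** * Symmetric Dyck paths and their first halves *)

Definition unfold (nu : word) : word := nu ++ map negb (rev nu).

Lemma zeros_negb w : zeros (map negb w) = ones w.
Proof. by rewrite /zeros /ones count_map; apply: eq_count => -[]. Qed.

Lemma ones_negb w : ones (map negb w) = zeros w.
Proof. by rewrite /zeros /ones count_map; apply: eq_count => -[]. Qed.

Lemma zeros_rev w : zeros (rev w) = zeros w.
Proof. exact: count_rev. Qed.

Lemma ones_rev w : ones (rev w) = ones w.
Proof. exact: count_rev. Qed.

Lemma size_unfold nu : size (unfold nu) = (size nu).*2.
Proof. by rewrite size_cat size_map size_rev addnn. Qed.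

Lemma first_half_unfold nu : first_half (unfold nu) = nu.
Proof. by rewrite /first_half size_unfold doubleK take_size_cat. Qed.

Lemma unfold_inj : injective unfold.
Proof. exact: can_inj first_half_unfold. Qed.

Lemma symmetric_unfold nu : symmetric_word (unfold nu).
Proof.
rewrite /symmetric_word /unfold rev_cat map_cat -map_rev revK -map_comp.
by rewrite (map_id_in (f := negb \o negb)) // => x _; apply: negbK.
Qed.

Lemma dyckE mu : dyck mu = (zeros mu == ones mu) && ballot mu.
Proof. by []. Qed.

(** Past the middle, the prefix of [unfold nu] of length [2 * size nu - j] has
    the same excess of 0's over 1's as its mirror image, the prefix of [nu] of
    length [j]. *)
Lemma dyck_unfold nu : dyck (unfold nu) = ballot nu.
Proof.
rewrite dyckE /unfold zeros_cat ones_cat zeros_negb ones_negb zeros_rev ones_rev.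
rewrite addnC eqxx /=; apply/ballotP/ballotP => H k.
  have [lekw|ltwk] := leqP k (size nu).
    by have := H k; rewrite takel_cat.
  have := H (size nu); rewrite takel_cat // take_size take_oversize //.
  exact: ltnW.
rewrite take_cat; case: ltnP => [_|lewk]; first exact: H.
rewrite zeros_cat ones_cat -map_take take_rev zeros_negb ones_negb.
rewrite zeros_rev ones_rev.
set j := (size nu - _); have := H j.
rewrite -[X in ones X + _](cat_take_drop j nu).
rewrite -[X in zeros X + _](cat_take_drop j nu).
by rewrite zeros_cat ones_cat; lia.
Qed.

Lemma symmetric_dyckP mu :
  dyck mu -> symmetric_word mu -> mu = unfold (first_half mu).
Proof.
rewrite dyckE => /andP[/eqP eq01 _] sym.
set m := (size mu)./2; have szE : size mu = m + m.
  by rewrite addnn /m -(zerosDones mu) -eq01; lia.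
rewrite /unfold /first_half -/m rev_take szE addnK map_drop -(eqP sym).
by rewrite cat_take_drop.
Qed.

(** A word that starts with 0 but does not have more 0's than 1's must return to
    balance, the excess changing by one at each letter; the prefix ending at the
    first return is prime. *)
Lemma prime_prefix_exists s :
  zeros (false :: s) <= ones (false :: s) ->
  exists2 k, k <= (size s).+1 & prime_dyck (take k (false :: s)).
Proof.
set w := false :: s => le01.
pose P k := (0 < k) && (zeros (take k w) <= ones (take k w)).
have exP : exists k, P k by exists (size w); rewrite /P take_size.
case: (ex_minnP exP) => k /andP[k_gt0 le_k] min_k.
have lekw : k <= size w by apply: min_k; rewrite /P take_size.
have pos j : 0 < j < k -> ones (take j w) < zeros (take j w).
  case/andP=> j_gt0; apply: contraTT; rewrite -!leqNgt => le_j.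
  by apply: min_k; rewrite /P j_gt0.
exists k => //.
have k_gt1 : 1 < k.
  by case: k k_gt0 le_k {min_k lekw pos} => [|[|k]] //= _; rewrite take0.
(* One letter before [k] the excess was still positive, hence it is now 0. *)
have eq01 : zeros (take k w) = ones (take k w).
  have := pos k.-1; have := take_nth false (_ : k.-1 < size w).
  rewrite (prednK k_gt0) => /(_ lekw) eq_k; move: le_k; rewrite eq_k.
  by rewrite zeros_rcons ones_rcons; case: (nth _ _ _) => /=; lia.
apply/and3P; split.
- rewrite dyckE eq01 eqxx /=; apply/ballotP => i.
  have [lejk|ltkj] := leqP k i; first by rewrite take_taker // eq01.
  rewrite take_takel; last exact: ltnW.
  case: (posnP i) => [->|i_gt0]; first by rewrite take0.
  by apply/ltnW/pos; rewrite i_gt0.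
- by rewrite -size_eq0 size_takel //; lia.
apply/allP => j; rewrite mem_iota size_takel // => j_in.
by rewrite take_takel; [have := pos j | ]; lia.
Qed.

(** In a Dyck word every 0 has exactly one partner: a suffix never has more 0's
    than 1's, so it has a prime prefix as soon as it starts with 0, and
    [closes] selects the shortest one. *)
Lemma closes_exactly_one mu i :
  dyck mu -> 0 < i <= size mu -> letter mu i = false ->
  exists2 j, i < j <= size mu & closes mu i =1 pred1 j.
Proof.
move=> mu_dyck /andP[i_gt0 lei] mui.
have lti : i.-1 < size mu by lia.
have [k lek prime_k] : exists2 k, k <= size (drop i.-1 mu) &
    prime_dyck (take k (drop i.-1 mu)).
  move: mu_dyck; rewrite dyckE => /andP[/eqP eq01 /ballotP/(_ i.-1) le_take].
  have := cat_take_drop i.-1 mu; have := drop_nth false lti.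
  rewrite -/(letter mu i) mui => drop_i mu_cat; rewrite drop_i.
  apply: prime_prefix_exists; rewrite -drop_i.
  by move: eq01; rewrite -{1 2}mu_cat zeros_cat ones_cat; lia.
have factorE j : i <= j -> factor mu i j = take (j - i.-1) (drop i.-1 mu).
  by move=> leij; rewrite take_drop subnK //; lia.
pose P j := (i < j) && prime_dyck (factor mu i j).
have Pk : P (k + i.-1).
  have k_gt1 : 1 < k.
    case: k prime_k {lek} => [|[|k]] //; first by rewrite take0.
    by rewrite (drop_nth false lti) /= take0 -/(letter mu i) mui.
  by rewrite /P factorE ?addnK ?prime_k ?andbT; lia.
case: (ex_minnP (ex_intro P _ Pk)) => j /andP[ltij prime_j] min_j.
have lej : j <= size mu by have := min_j _ Pk; move: lek; rewrite size_drop; lia.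
exists j; first by rewrite ltij.
move=> l /=; apply/and4P/eqP => [[ltil lel prime_l /allP min_l]|->].
  apply/eqP; rewrite eqn_leq min_j ?/P ?ltil // andbT leqNgt.
  apply/negP => ltjl; suff: ~~ prime_dyck (factor mu i j) by rewrite prime_j.
  by apply: min_l; rewrite mem_iota; lia.
split=> //; apply/allP => l'; rewrite mem_iota => l'_in.
apply/negP => prime_l'; have := min_j l'; rewrite /P prime_l'; lia.
Qed.

(** The partner of a 0 of the first half makes it an arch or a half-arch, never
    both, according to the half in which it lies. *)
Lemma path_size_dyck mu :
  dyck mu -> path_size mu = zeros (first_half mu).
Proof.
move=> mu_dyck; have szE : size mu = (size mu)./2 + (size mu)./2.
  move: mu_dyck; rewrite dyckE -(zerosDones mu) => /andP[/eqP-> _]; lia.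
rewrite /path_size /arches /half_arches /first_half; move: szE.
move: (_./2) => m szE.
rewrite !size_filter -!sum1_count big_mkcond big_allpairs.
rewrite [X in _ + X]big_mkcond -big_split /=.
have -> : zeros (take m mu) = \sum_(i <- iota 1 m) (letter mu i == false).
  rewrite -(map_nth_iota0 false); last by rewrite szE leq_addr.
  rewrite /zeros count_map -sum1_count big_mkcond (iotaDl 1 0) big_map /=.
  by apply: eq_bigr => i _; rewrite /letter /=; case: nth.
apply: eq_big_seq => i; rewrite mem_iota add1n ltnS => /andP[i_gt0 lei].
case: eqP => [mui|_]; last by rewrite big1.
have [||j /andP[ltij lej] closesE] := closes_exactly_one mu_dyck (i := i) => //.
  by rewrite i_gt0; lia.
rewrite -big_mkcond sum1_count (eq_count closesE) (eq_has closesE).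
rewrite has_pred1 count_uniq_mem ?iota_uniq // !mem_iota.
by rewrite (leq_ltn_trans _ ltij) //= add1n ltnS addSn ltnS -szE lej; case: leqP.
Qed.

(** A ballot word with [n] zeros has at most [n] ones, whence the bound on the
    length.  It exceeds the least possible one by one, which does not change the
    set and suits the summation in [sum_maj_ballot]. *)
Lemma symDyckE n :
  symDyck n =
  [set` [seq unfold nu | nu <- words_lt n.*2.+2 & ballot nu && (zeros nu == n)]]%classic.
Proof.
(* The bound is made opaque so that simplification does not expand the
   enumeration. *)
have [L leL] : {L | n.*2.+2 = L} by exists n.*2.+2.
rewrite leL; apply/seteqP; split=> mu /=.
  case/and3P=> mu_dyck mu_sym /eqP szmu.
  have muE := symmetric_dyckP mu_dyck mu_sym.
  move: szmu mu_dyck; rewrite muE => szmu nu_dyck.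
  have := path_size_dyck nu_dyck; rewrite szmu first_half_unfold => zE.
  move: nu_dyck; rewrite dyck_unfold => nu_ballot.
  apply/mapP; exists (first_half mu) => //.
  rewrite mem_filter mem_words_lt nu_ballot zE eqxx /=.
  by have := ballot_le nu_ballot; rewrite -zerosDones; lia.
case/mapP=> nu; rewrite mem_filter => /andP[/andP[nu_ballot /eqP zE] _] ->.
rewrite /symDyck /= dyck_unfold nu_ballot symmetric_unfold.
by rewrite path_size_dyck ?dyck_unfold // first_half_unfold zE eqxx.
Qed.

(** * Generating functions of ballot words *)

Local Open Scope ring_scope.

Section GeneratingFunctions.

Variables (F : fieldType) (q : F).

Definition ballotGF (stat : word -> nat) (m a : nat) : F :=
  \sum_(w <- words m | ballot w && (zeros w == a)) q ^+ stat w.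

Lemma ballotGF_oversize stat m a : (m < a)%N -> ballotGF stat m a = 0.
Proof.
move=> ltma; rewrite /ballotGF big_seq_cond big1 // => w.
rewrite mem_words => /and3P[/eqP szw _ /eqP zw].
by exfalso; move: (zerosDones w); rewrite szw zw; lia.
Qed.

Lemma ballotGF_nonballot stat m a : (a.*2 < m)%N -> ballotGF stat m a = 0.
Proof.
move=> ltam; rewrite /ballotGF big_seq_cond big1 // => w.
rewrite mem_words => /and3P[/eqP szw /ballot_le le10 /eqP zw].
by exfalso; move: le10 (zerosDones w); rewrite szw zw; lia.
Qed.

(** The bound on [m] says that a word with [a.+1] zeros remains a ballot word
    when a final 1 brings its length to [m.+1]. *)
Lemma ballotGF_rcons stat m a : (m <= a.*2.+1)%N ->
  ballotGF stat m.+1 a.+1 =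
    \sum_(w <- words m | ballot w && (zeros w == a)) q ^+ stat (rcons w false) +
    \sum_(w <- words m | ballot w && (zeros w == a.+1)) q ^+ stat (rcons w true).
Proof.
move=> lema; rewrite /ballotGF /= big_cat !big_map; congr (_ + _).
  apply: eq_bigl => w; rewrite ballot_rcons zeros_rcons addn0 addn1 eqSS.
  case: (boolP (ballot w)) => //= /ballot_le le10.
  by rewrite (leq_trans le10).
rewrite big_seq_cond [RHS]big_seq_cond; apply: eq_bigl => w.
rewrite mem_words ballot_rcons zeros_rcons addn0 addn1.
case: eqP => //= szw; case: (boolP (ballot w)) => //= _.
case: eqP => [zw|]; rewrite ?andbF // andbT.
by move: (zerosDones w); rewrite szw zw; lia.
Qed.

Lemma ballotGF_inner_rec m a : (m <= a.*2.+1)%N ->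
  ballotGF inner_maj m.+1 a.+1 = ballotGF maj m a + ballotGF inner_maj m a.+1.
Proof.
move=> lema; rewrite ballotGF_rcons //; congr (_ + _);
  by apply: eq_bigr => w _; rewrite inner_maj_rcons.
Qed.

Lemma ballotGF_maj_rec m a : (m <= a.*2.+1)%N ->
  ballotGF maj m.+1 a.+1 =
    ballotGF maj m a + q ^+ m.+1 * ballotGF inner_maj m a.+1.
Proof.
move=> lema; rewrite ballotGF_rcons //; congr (_ + _).
  by apply: eq_bigr => w _; rewrite maj_rcons.
rewrite /ballotGF big_distrr /= big_seq_cond [RHS]big_seq_cond.
apply: eq_bigr => w; rewrite mem_words => /andP[/eqP szw _].
by rewrite maj_rcons szw exprD mulrC.
Qed.

(** Both sides increase by [ballotGF maj L n] when [L] does.  In terms of words: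
    the ballot words of length [L] with [n.+1] zeros are the [nu 0 1 ... 1] with
    [nu] a shorter ballot word with [n] zeros. *)
Lemma sum_maj_inner n L : (L <= n.*2.+2)%N ->
  \sum_(w <- words_lt L | ballot w && (zeros w == n)) q ^+ maj w =
    ballotGF inner_maj L n.+1.
Proof.
elim: L => [|L IHL] leL; first by rewrite big_nil ballotGF_oversize.
by rewrite big_cat /= IHL ?ballotGF_inner_rec 1?addrC //; lia.
Qed.

(** * The closed form *)

Hypothesis q_nonroot : forall i, (0 < i)%N -> 1 - q ^+ i != 0.

Lemma qpochS m : qpoch q m.+1 = qpoch q m * (1 - q ^+ m.+1).
Proof. by rewrite /qpoch big_nat_recr. Qed.

Lemma qpoch0 : qpoch q 0 = 1.
Proof. by rewrite /qpoch big_geq. Qed.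

Lemma qpoch_neq0 m : qpoch q m != 0.
Proof.
elim: m => [|m IHm]; first by rewrite qpoch0 oner_eq0.
by rewrite qpochS mulf_neq0 ?q_nonroot.
Qed.

(** The Gaussian binomials [a + b, b] and [a + b, b - 1] are the products of this
    quantity by 1 - q^(a + 1) and 1 - q^b; factoring it out avoids a separate
    convention for [a + b, b - 1] at b = 0. *)
Definition ballot_weight (a b : nat) : F :=
  qpoch q (a + b) / (qpoch q a.+1 * qpoch q b).

(** These are q^b ([a + b, b] - [a + b, b - 1]) and
    [a + b, b] - q [a + b, b - 1].  Ballot words require b <= a, but the first
    formula correctly vanishes at b = a + 1; the recurrence reaches this boundary
    case when b = a. *)
Lemma ballotGF_closed a b :
  ((b <= a.+1)%N ->
     ballotGF maj (a + b) a = ballot_weight a b * q ^+ b * (q ^+ b - q ^+ a.+1)) /\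
  ((b <= a)%N ->
     ballotGF inner_maj (a + b) a =
       ballot_weight a b * (1 - q - q ^+ a.+1 + q ^+ b.+1)).
Proof.
have [m] := ubnP (a + b)%N; elim: m a b => // m IHm a b ltm.
have weight0 c : ballot_weight c 0 = (1 - q ^+ c.+1)^-1.
  rewrite /ballot_weight addn0 qpoch0 qpochS mulr1 invfM mulrA.
  by rewrite divff ?mul1r ?qpoch_neq0.
case: a b ltm => [|a] [|b] ltm.
- rewrite weight0 /ballotGF !big_cons !big_nil /= expr1.
  rewrite /maj /inner_maj /Des /= !big_nil !expr0.
  have := q_nonroot (isT : 0 < 1)%N; rewrite expr1 => nz.
  by split=> _; field.
- split=> //; case: b ltm => // ltm _.
  by rewrite ballotGF_nonballot // subrr mulr0.
- have [majE' _] := IHm a 0%N ltac:(lia).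
  rewrite addn0 in majE'; rewrite addn0 ballotGF_maj_rec ?ballotGF_inner_rec;
    [|lia..].
  rewrite [ballotGF inner_maj a a.+1]ballotGF_oversize //.
  rewrite mulr0 addr0 majE' // !weight0 !expr0.
  have nz1 := q_nonroot (ltn0Sn a); have nz2 := q_nonroot (ltn0Sn a.+1).
  move: nz1 nz2; rewrite !exprS => nz1 nz2.
  by split=> _; field; rewrite nz1 nz2.
have [majE' _] := IHm a b.+1 ltac:(lia).
have [_ innerE'] := IHm a.+1 b ltac:(lia).
have [leba|ltab] := leqP b a; last first.
  split=> leba; last by lia.
  have -> : b = a.+1 by lia.
  by rewrite ballotGF_nonballot ?subrr ?mulr0 //; lia.
(* A common factor of the three weights in the recurrences, which reduces them to
   polynomial identities in the powers of [q]. *)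
pose t := qpoch q (a + b).+1 / (qpoch q a.+2 * qpoch q b.+1).
have nza := q_nonroot (ltn0Sn a.+1); have nzb := q_nonroot (ltn0Sn b).
have weight_left : ballot_weight a b.+1 = t * (1 - q ^+ a.+2).
  rewrite /ballot_weight /t addnS (qpochS a.+1); field.
  by rewrite nza !qpoch_neq0.
have weight_below : ballot_weight a.+1 b = t * (1 - q ^+ b.+1).
  rewrite /ballot_weight /t addSn (qpochS b); field.
  by rewrite nzb !qpoch_neq0.
have weight_here : ballot_weight a.+1 b.+1 = t * (1 - q ^+ (a + b).+2).
  rewrite /ballot_weight /t addSn addnS (qpochS (a + b).+1); field.
  by rewrite !qpoch_neq0.
have eqE : (a.+1 + b = a + b.+1)%N by lia.
rewrite eqE in innerE'.
rewrite addSn ballotGF_maj_rec ?ballotGF_inner_rec; [|lia..].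
rewrite majE' ?innerE' ?weight_left ?weight_below ?weight_here; [|lia..].
by rewrite addnS !exprS !exprD; split=> _; ring.
Qed.

Lemma qintE k : qint q k = (1 - q ^+ k) / (1 - q).
Proof.
have nz1 := q_nonroot (isT : 0 < 1)%N; rewrite expr1 in nz1.
apply: (mulIf nz1); rewrite divfK // mulrC.
by have := subrX1 q k; rewrite -(opprB 1) -(opprB 1 q) mulNr => /oppr_inj ->.
Qed.

(** At [a = b] the numerator of the closed form collapses to 1 - q, which turns
    [ballot_weight n.+1 n.+1] into the q-Catalan number. *)
Lemma sum_maj_ballot n :
  \sum_(w <- words_lt n.*2.+2 | ballot w && (zeros w == n)) q ^+ maj w =
    1 / qint q (n + 2) * qbinom q (2 * (n + 1)) (n + 1).
Proof.
have [_ innerE] := ballotGF_closed n.+1 n.+1.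
have eqN : (n.*2.+2 = n.+1 + n.+1)%N by lia.
rewrite sum_maj_inner // eqN innerE // addrNK /ballot_weight qintE /qbinom.
have -> : (2 * (n + 1) - (n + 1) = n.+1)%N by lia.
have -> : (2 * (n + 1) = n.+1 + n.+1)%N by lia.
rewrite !addn1 addn2 (qpochS n.+1); field.
have := q_nonroot (isT : 0 < 1)%N; rewrite expr1 => ->.
by rewrite q_nonroot ?qpoch_neq0.
Qed.

End GeneratingFunctions.

Lemma qvar_nonroot i : (0 < i)%N -> 1 - qvar ^+ i != 0.
Proof.
case: i => // i _.
rewrite /qvar -tofracXn -tofrac1 -tofracB tofrac_eq0 -oppr_eq0 opprB.
by rewrite -size_poly_eq0 size_XnsubC.
Qed.

Theorem theorem6p3 (n : nat) (hn : (1 <= n)%N) :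
  \sum_(mu \in symDyck n) qvar ^+ maj (first_half mu) =
    1 / qint qvar (n + 2) * qbinom qvar (2 * (n + 1)) (n + 1).
Proof.
rewrite symDyckE -fsbig_seq; last first.
  by rewrite (map_inj_uniq unfold_inj) filter_uniq ?words_lt_uniq.
rewrite big_map big_filter -(sum_maj_ballot qvar_nonroot).
by apply: eq_bigr => nu _; rewrite first_half_unfold.
Qed.
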